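(* For $k\geq1$, the variety $\mathcal P_k$ is finitely based if and only if $k\leq2$. Moreover, $\mathcal P_1<\mathcal P_2<\mathcal P_3<\cdots$ and $\bigvee_{k\geq1}\mathcal P_k=\mathcal M$.
   Context: An additively idempotent semiring (ai-semiring) is an algebra $(S,+,\cdot)$ of signature $(2,2)$, without constants, such that $(S,+)$ is a commutative idempotent semigroup, $(S,\cdot)$ is a semigroup, and multiplication distributes over addition. All varieties are in the signature $(2,2)$; $<$ between varieties is proper inclusion, and $\bigvee$ is the join of varieties. A variety is finitely based if it can be defined by finitely many identities. $\mathbf N$ is the ai-semiring on the nonnegative integers $\mathbb N_0$ whose semiring addition is $\max$ and whose semiring multiplication is numerical addition; $\mathcal M=\mathsf V(\mathbf N)$ is the variety it generates. For $k\geq1$, $\mathcal P_k$ is the subvariety of $\mathcal M$ defined within $\mathcal M$ by the identity $x^k\approx x^{k+1}$. *)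

(* Defs.v *)
From Stdlib Require List.
From mathcomp Require Import all_boot.
From mathcomp Require Import boolp.

Set Implicit Arguments.
Unset Strict Implicit.
Unset Printing Implicit Defensive.

(* Algebras of signature (2,2), on a nonempty carrier. *)
Record algebra : Type := Algebra {
  carrier :> Type;
  add : carrier -> carrier -> carrier;
  mul : carrier -> carrier -> carrier;
  nonempty : inhabited carrier }.

Record is_ai_semiring (A : algebra) : Prop := IsAiSemiring {
  ai_addA : associative (@add A);
  ai_addC : commutative (@add A);
  ai_addI : idempotent_op (@add A);
  ai_mulA : associative (@mul A);
  ai_mulDl : left_distributive (@mul A) (@add A);
  ai_mulDr : right_distributive (@mul A) (@add A) }.

Definition hom (A B : algebra) (f : A -> B) : Prop :=
  {morph f : x y / add x y >-> add x y} /\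
  {morph f : x y / mul x y >-> mul x y}.

Lemma prod_nonempty (I : Type) (A : I -> algebra) :
  inhabited (forall i, A i).
Proof.
constructor=> i; apply: (proj1_sig (cid (P := fun _ : A i => True) _)).
by case: (nonempty (A i)) => x; exists x.
Qed.

Definition prod_algebra (I : Type) (A : I -> algebra) : algebra :=
  {| carrier := forall i, A i;
     add := fun f g i => add (f i) (g i);
     mul := fun f g i => mul (f i) (g i);
     nonempty := prod_nonempty A |}.

(* The variables are indexed by nat. *)
Inductive term : Type :=
  | Var of nat
  | Add of term & term
  | Mul of term & term.

Fixpoint eval (A : algebra) (v : nat -> A) (t : term) : A :=
  match t with
  | Var n => v n
  | Add s t => add (eval v s) (eval v t)
  | Mul s t => mul (eval v s) (eval v t)
  end.

Definition identity : Type := (term * term)%type.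

Definition satisfies (A : algebra) (e : identity) : Prop :=
  forall v : nat -> A, eval v e.1 = eval v e.2.

Definition models (E : identity -> Prop) (A : algebra) : Prop :=
  forall e, E e -> satisfies A e.

Definition alg_class : Type := algebra -> Prop.

Definition sub_class (K L : alg_class) : Prop := forall A, K A -> L A.

Definition eq_class (K L : alg_class) : Prop := forall A, K A <-> L A.

Definition proper_class (K L : alg_class) : Prop :=
  sub_class K L /\ ~ sub_class L K.

(* Subalgebras are taken up to isomorphism, i.e., as embedded algebras. *)
Record variety (K : alg_class) : Prop := Variety {
  variety_hom_image : forall (A B : algebra) (f : A -> B),
    hom f -> (forall y, exists x, f x = y) -> K A -> K B;
  variety_subalgebra : forall (A B : algebra) (f : B -> A),
    hom f -> injective f -> K A -> K B;
  variety_product : forall (I : Type) (A : I -> algebra),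
    (forall i, K (A i)) -> K (prod_algebra A) }.

(* The least variety including the class C. *)
Definition generated (C : alg_class) : alg_class :=
  fun A => forall K, variety K -> sub_class C K -> K A.

Definition join (I : Type) (D : I -> Prop) (K : I -> alg_class) : alg_class :=
  generated (fun A => exists2 i, D i & K i A).

Definition finitely_based (K : alg_class) : Prop :=
  exists E : seq identity, eq_class K (models (fun e => List.In e E)).

Definition algN : algebra :=
  {| carrier := nat; add := maxn; mul := addn; nonempty := inhabits 0 |}.

Definition varM : alg_class := generated (fun A => A = algN).

(* The power t ^ k for k >= 1; there is no unit, and the value at k = 0 is
   meaningless. *)
Definition tpow (t : term) (k : nat) : term := iter k.-1 (Mul t) t.

Definition varP (k : nat) : alg_class :=
  fun A => varM A /\ satisfies A (tpow (Var 0) k, tpow (Var 0) k.+1).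

Lemma algN_ai_semiring : is_ai_semiring algN.
Proof.
split; [exact: maxnA|exact: maxnC|exact: maxnn|exact: addnA|..].
- by move=> x y z; rewrite /= addn_maxl.
- by move=> x y z; rewrite /= addn_maxr.
Qed.

Lemma generated_variety (C : alg_class) : variety (generated C).
Proof.
split.
- move=> A B f hf sf KA L VL CL.
  exact: (variety_hom_image VL hf sf (KA L VL CL)).
- move=> A B f hf jf KA L VL CL.
  exact: (variety_subalgebra VL hf jf (KA L VL CL)).
- move=> I A KA L VL CL; apply: (variety_product VL) => i.
  exact: KA.
Qed.

Lemma eval_hom (A B : algebra) (f : A -> B) (v : nat -> A) (t : term) :
  hom f -> f (eval v t) = eval (fun n => f (v n)) t.
Proof.
case=> fD fM; elim: t => //= [s IHs t IHt|s IHs t IHt].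
- by rewrite fD IHs IHt.
- by rewrite fM IHs IHt.
Qed.

Lemma models_variety (E : identity -> Prop) : variety (models E).
Proof.
split.
- move=> A B f hf sf mA e Ee v.
  have [w fw] := choice (fun n => sf (v n)).
  have -> : v = (fun n => f (w n)) by apply: funext => n; rewrite fw.
  by rewrite -!(eval_hom _ _ hf) (mA e Ee).
- move=> A B f hf jf mA e Ee v; apply: jf.
  by rewrite !(eval_hom _ _ hf) (mA e Ee).
- move=> I A mA e Ee v.
  apply: functional_extensionality_dep => i.
  have hi : @hom (prod_algebra A) (A i) (fun g => g i) by [].
  by rewrite !(eval_hom v _ hi) (mA i e Ee).
Qed.

Lemma varM_variety : variety varM.
Proof. exact: generated_variety. Qed.

Lemma varP_variety (k : nat) : variety (varP k).
Proof.
pose e : identity := (tpow (Var 0) k, tpow (Var 0) k.+1).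
have eE A : satisfies A e <-> models (fun e' => e' = e) A.
  by split=> [sA _ ->|mA] //; exact: mA.
have Ve := models_variety (fun e' => e' = e).
split.
- move=> A B f hf sf [MA /eE sA]; split.
    exact: (variety_hom_image varM_variety hf sf MA).
  by apply/eE; exact: (variety_hom_image Ve hf sf sA).
- move=> A B f hf jf [MA /eE sA]; split.
    exact: (variety_subalgebra varM_variety hf jf MA).
  by apply/eE; exact: (variety_subalgebra Ve hf jf sA).
- move=> I A KA; split.
    by apply: (variety_product varM_variety) => i; case: (KA i).
  apply/eE; apply: (variety_product Ve) => i; apply/eE.
  by case: (KA i).
Qed.

(* Main.v *)
From mathcomp Require Import all_boot boolp zify.
Require Import Defs.

Set Implicit Arguments.
Unset Strict Implicit.
Unset Printing Implicit Defensive.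

(** A term is a finite sum of words, and over N a word w is a linear form
[weight a w] in the values a of the letters, a term being the maximum of its
words.  So an identity of N compares maxima of linear forms, and
[weight a w <= weight a t] for all a means that w lies below the convex hull
of the words of t.  By Birkhoff's theorem ([birkhoff]), M consists of the
algebras satisfying all these identities.

Chain and join.  The truncation of N at k is a quotient of N satisfying
x^j = x^(j+1) exactly when k <= j, which separates the P_k; and N embeds in
the product of its truncations, which gives the join.

The case k <= 2.  In the presence of x^2 = x^3 the identities of N follow from
a few simple ones, chiefly x <= xy and xy <= x^2 + y^2 ([ev_le]).  Suppose w is
dominated by the words of t.  If every letter of w occurs twice in some word of
t, then t is above the sum of the squares of the letters of w, which equals the
square, hence every power, of the sum of these letters, hence is above w.
Otherwise some letter i of w occurs at most once in each word of t; making the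
value of i huge shows that the words of t containing i already dominate w once
i is cancelled on both sides, and one concludes by induction.

The case k >= 3.  Over n cyclically ordered letters let [cyc n i] be the word
obtained from x_1...x_n by replacing the letter after x_i with a second x_i.
The average of these n words is x_1...x_n, so N satisfies
x_1...x_n <= cyc_1 + ... + cyc_n.  But any word below the hull of fewer than n
of them divides one of them ([hull_cyc_divisor]), so that this inequality does
not follow from instances of identities producing fewer than n words.  This is
made precise with syntactic quotients [synt D] of the term algebra, in which two
terms agree when they have the same contexts p such that all the words of p t
lie in D.  For D the hull of some of the [cyc n i] the quotient is in P_3, as
no letter occurs three times in a word of D; for D the set of divisors of the
[cyc n i] it fails the inequality above, yet it satisfies each identity of P_k
that is small with respect to n, because any failure would involve fewer than
n of the words and would already occur in the quotient for their hull
([small_identity]). *)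

(** * Quotients and the variety M *)

Lemma varM_satisfies (A : algebra) (e : identity) :
  varM A -> satisfies algN e -> satisfies A e.
Proof.
move=> MA Ne; apply: (MA (models (fun e' => e' = e))) => //.
- exact: models_variety.
- by move=> B -> e' ->.
Qed.

(** The quotient of A by the kernel of a map phi is realized as the image of
phi, so that congruence classes need not be handled as sets. *)
Section Quotient.
Variables (A : algebra) (T : Type) (phi : A -> T).

Definition quotient_carrier : Type := {y : T | exists x, phi x = y}.

Definition proj (x : A) : quotient_carrier :=
  exist _ (phi x) (ex_intro _ x erefl).

(** A chosen preimage, through which the operations of the quotient are
defined. *)
Definition repr (y : quotient_carrier) : A := sval (cid (svalP y)).

Lemma quotient_nonempty : inhabited quotient_carrier.
Proof. by case: (nonempty A) => x; constructor; exact: (proj x). Qed.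

Definition quotient : algebra :=
  {| carrier := quotient_carrier;
     add := fun y z => proj (add (repr y) (repr z));
     mul := fun y z => proj (mul (repr y) (repr z));
     nonempty := quotient_nonempty |}.

Lemma quotient_inj (y z : quotient_carrier) : sval y = sval z -> y = z.
Proof. by case: y z => y hy [z hz] /= yz; apply: eq_exist. Qed.

Lemma proj_eq x y : proj x = proj y <-> phi x = phi y.
Proof.
split=> [/(congr1 sval)//|eq_xy].
exact: quotient_inj.
Qed.

Lemma phi_repr y : phi (repr y) = sval y.
Proof. by rewrite /repr; case: cid. Qed.

Lemma reprK y : proj (repr y) = y.
Proof. by apply: quotient_inj; exact: phi_repr. Qed.

Hypothesis phiD : forall x x' y y' : A,
  phi x = phi x' -> phi y = phi y' -> phi (add x y) = phi (add x' y').
Hypothesis phiM : forall x x' y y' : A,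
  phi x = phi x' -> phi y = phi y' -> phi (mul x y) = phi (mul x' y').

Lemma proj_hom : @hom A quotient proj.
Proof.
by split=> x y; apply/proj_eq; [apply: phiD|apply: phiM]; rewrite phi_repr.
Qed.

Lemma satisfies_quotient (e : identity) :
  satisfies quotient e <->
  forall v : nat -> A, phi (eval v e.1) = phi (eval v e.2).
Proof.
split=> [Qe v|Ae v].
  by apply/proj_eq; rewrite !(eval_hom v _ proj_hom); exact: Qe.
have -> : v = fun n => proj (repr (v n)) by apply: funext => n; rewrite reprK.
by rewrite -!(eval_hom (fun n => repr (v n)) _ proj_hom); apply/proj_eq.
Qed.

End Quotient.

(** * Birkhoff's theorem *)

(** The absolutely free algebra, in which evaluation is substitution. *)
Definition algT : algebra :=
  {| carrier := term; add := Add; mul := Mul; nonempty := inhabits (Var 0) |}.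

Lemma eval_subst (A : algebra) (v : nat -> A) (s : nat -> algT) (t : term) :
  eval v (eval s t : term) = eval (fun n => eval v (s n : term)) t.
Proof. exact: (@eval_hom algT A (fun t : algT => eval v t) s t). Qed.

Section Birkhoff.
Variables A B : algebra.
Hypothesis AB : forall e, satisfies B e -> satisfies A e.

(** Variables with the same value under v must first be identified, by
renaming each variable n to a canonical variable g (v n): only then does every
valuation in B factor through v. *)
Lemma eval_eq_of_products (v : nat -> A) (s t : term) :
  (forall w : A -> B, eval (fun n => w (v n)) s = eval (fun n => w (v n)) t) ->
  eval v s = eval v t.
Proof.
move=> st.
pose g (a : A) : nat :=
  if pselect (exists m, v m = a) is left e then sval (cid e) else 0.
have vg n : v (g (v n)) = v n.
  rewrite /g; case: pselect => [e|[]]; first by case: cid.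
  by exists n.
pose c n : algT := Var (g (v n)).
have ev r : eval v r = eval v (eval c r : term).
  by rewrite eval_subst; congr eval; apply: funext => n /=; rewrite vg.
rewrite (ev s) (ev t).
apply: (AB (e := (eval c s : term, eval c t : term))) => x /=.
rewrite !eval_subst; exact: (st (fun a => x (g a))).
Qed.

(** The subalgebra of the power B^(A -> B) generated by the evaluations at the
elements of A, i.e., the algebra of those functions that some term with
constants in A induces. *)
Let sub_carrier : Type := {f : (A -> B) -> B |
  exists tv : term * (nat -> A), f = fun w => eval (fun n => w (tv.2 n)) tv.1}.

(** Two valuations can be played by one, on disjoint sets of variables. *)
Lemma merge (v v' : nat -> A) : exists (u : nat -> A) (c c' : nat -> nat),
  (forall n, u (c n) = v n) /\ (forall n, u (c' n) = v' n).
Proof.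
exists (fun n => if odd n then v n./2 else v' n./2).
exists (fun n => n.*2.+1), (fun n => n.*2).
split=> n; first by rewrite /= odd_double uphalf_double.
by rewrite odd_double doubleK.
Qed.

Lemma merge_terms (s t : term) (v v' : nat -> A) :
  exists (s' t' : term) (u : nat -> A),
  (eval u s' = eval v s /\ eval u t' = eval v' t) /\
  forall (w : A -> B),
   eval (fun n => w (u n)) s' = eval (fun n => w (v n)) s /\
   eval (fun n => w (u n)) t' = eval (fun n => w (v' n)) t.
Proof.
have [u [c [c' [uc uc']]]] := merge v v'.
exists (eval (fun n => Var (c n) : algT) s : term).
exists (eval (fun n => Var (c' n) : algT) t : term), u.
split; [split|move=> w; split]; rewrite eval_subst; congr eval;
  apply: funext => n /=; by rewrite ?uc ?uc'.
Qed.

(** Sending the function induced by a term with constants in A to the value of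
this term is well defined by [eval_eq_of_products], and maps a subalgebra of a
power of B onto A. *)
Lemma birkhoff : generated (fun C => C = B) A.
Proof.
move=> K VK KB.
pose P := prod_algebra (fun _ : A -> B => B).
have KP : K P by apply: (variety_product VK) => _; exact: KB.
have closed op top (topE : forall (C : algebra) (v : nat -> C) s t,
    eval v (top s t) = op C (eval v s) (eval v t))
    (f g : sub_carrier) : exists tv : term * (nat -> A),
    (fun w => op B (sval f w) (sval g w)) =
    fun w => eval (fun n => w (tv.2 n)) tv.1.
  case: f g => f [[s v] /= ->] [g [[t v'] /= ->]].
  have [s' [t' [u [_ e]]]] := merge_terms s t v v'.
  exists (top s' t', u); apply: funext => w /=.
  by have [e1 e2] := e w; rewrite topE e1 e2.
have clD := closed (@add) Add (fun _ _ _ _ => erefl).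
have clM := closed (@mul) Mul (fun _ _ _ _ => erefl).
have ne : inhabited sub_carrier.
  case: (nonempty A) => a; constructor.
  by exists (fun w => w a), (Var 0, fun=> a).
pose S := {| carrier := sub_carrier;
  add := fun f g => exist _ _ (clD f g) : sub_carrier;
  mul := fun f g => exist _ _ (clM f g) : sub_carrier;
  nonempty := ne |}.
have KS : K S.
  apply: (variety_subalgebra VK (f := fun f : S => sval f : P) _ _ KP) => //.
  by move=> [f hf] [g hg] /= fg; apply: eq_exist.
pose h (f : S) : A := let tv := sval (cid (svalP f)) in eval tv.2 tv.1.
have hE (f : S) t v : sval f = (fun w => eval (fun n => w (v n)) t) ->
    h f = eval v t.
  rewrite /h; case: cid => -[s v'] /= -> st.
  have [s' [t' [u [[<- <-] e]]]] := merge_terms s t v' v.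
  apply: eval_eq_of_products => w; have [-> ->] := e w.
  exact: (congr1 (fun F => F w) st).
apply: (variety_hom_image VK (f := h) _ _ KS).
  have hop op top (topE : forall (C : algebra) (v : nat -> C) s t,
      eval v (top s t) = op C (eval v s) (eval v t)) (f g k : S) :
      sval k = (fun w => op B (sval f w) (sval g w)) ->
      h k = op A (h f) (h g).
    case: f g => f [[s v] /= ef] [g [[t v'] /= eg]] /= ek.
    rewrite (hE (exist _ f _) s v ef) (hE (exist _ g _) t v' eg).
    have [s' [t' [u [[<- <-] e]]]] := merge_terms s t v v'.
    rewrite -topE; apply: hE; rewrite ek ef eg; apply: funext => w.
    by have [<- <-] := e w; rewrite topE.
  split=> f g.
    exact: (hop (@add) Add (fun _ _ _ _ => erefl)).
  exact: (hop (@mul) Mul (fun _ _ _ _ => erefl)).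
move=> a.
have ha : exists tv : term * (nat -> A), (fun w : A -> B => w a) =
    fun w => eval (fun n => w (tv.2 n)) tv.1 by exists (Var 0, fun=> a).
exists (exist _ _ ha : S); exact: (hE _ (Var 0) (fun=> a)).
Qed.

End Birkhoff.

(** * Truncations: the chain and its join *)

Definition trunc (k : nat) : algebra := quotient (A := algN) (minn k).

Lemma trunc_hom k : @hom algN (trunc k) (proj (A := algN) (minn k)).
Proof. by apply: proj_hom => /= x x' y y'; lia. Qed.

Lemma satisfies_trunc k (e : identity) :
  satisfies (trunc k) e <->
  forall v : nat -> algN, minn k (eval v e.1) = minn k (eval v e.2).
Proof. by apply: satisfies_quotient => /= x x' y y'; lia. Qed.

Lemma varM_algN : varM algN.
Proof. by move=> K _; apply. Qed.

Lemma varM_trunc k : varM (trunc k).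
Proof.
apply: (variety_hom_image varM_variety (trunc_hom k) _ varM_algN) => y.
by exists (repr y); exact: reprK.
Qed.

Lemma eval_tpow_algN (v : nat -> algN) t k :
  0 < k -> eval v (tpow t k) = k * (eval v t : nat).
Proof.
case: k => // k _; rewrite /tpow /=.
elim: k => [|k IHk] /=; first by rewrite mul1n.
by rewrite IHk -mulSn.
Qed.

Lemma trunc_power k j : 0 < j ->
  satisfies (trunc k) (tpow (Var 0) j, tpow (Var 0) j.+1) <-> k <= j.
Proof.
move=> j0; split=> [/satisfies_trunc/(_ (fun=> 1))|kj].
  by rewrite /= !eval_tpow_algN //=; lia.
apply/satisfies_trunc => v /=; rewrite !eval_tpow_algN //=.
case: (v 0) => [|x]; nia.
Qed.

Lemma varP_trunc k : 0 < k -> varP k (trunc k).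
Proof. by move=> k0; split; [exact: varM_trunc|apply/trunc_power]. Qed.

Lemma varP_proper k : 0 < k -> proper_class (varP k) (varP k.+1).
Proof.
case: k => // k _; split=> [A [MA Ak]|].
  split=> // v; exact: (congr1 (mul (v 0)) (Ak v)).
move=> /(_ _ (varP_trunc (ltn0Sn k.+1)))[_ /trunc_power].
by rewrite ltnn => /(_ isT).
Qed.

(** The map n |-> (min n k)_k embeds N in the product of its truncations, since
m and n are separated at any k above both. *)
Lemma join_varP : eq_class (join (fun k : nat => 1 <= k) varP) varM.
Proof.
move=> A; split=> [jA|MA].
  apply: jA; first exact: varM_variety.
  by move=> B [k _ []].
move=> K VK PK; apply: (MA _ VK) => _ ->.
pose f (n : algN) : prod_algebra (fun k => trunc k.+1) :=
  fun k => proj (A := algN) (minn k.+1) n.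
apply: (variety_subalgebra VK (f := f)).
- split=> m n; apply: functional_extensionality_dep => k;
    by have [hD hM] := trunc_hom k.+1; rewrite /f (hD, hM).
- move=> m n fmn.
  have : f m (maxn m n) = f n (maxn m n) by rewrite fmn.
  by move/proj_eq; lia.
- apply: (variety_product VK) => k; apply: PK; exists k.+1 => //.
  exact: varP_trunc.
Qed.

(** * Words of a term *)

(** The words whose sum is the expansion of a term by distributivity. *)
Fixpoint words (t : term) : seq (seq nat) :=
  match t with
  | Var n => [:: [:: n]]
  | Add s t => words s ++ words t
  | Mul s t => [seq x ++ y | x <- words s, y <- words t]
  end.

(** The value in N of the word w when the letters take the values a. *)
Definition weight (a : nat -> nat) (w : seq nat) : nat := \sum_(i <- w) a i.

Lemma weight_cat a w z : weight a (w ++ z) = weight a w + weight a z.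
Proof. exact: big_cat. Qed.

Lemma weight_cons a i w : weight a (i :: w) = a i + weight a w.
Proof. exact: big_cons. Qed.

Lemma weight_perm a w z : perm_eq w z -> weight a w = weight a z.
Proof. exact: perm_big. Qed.

Lemma words_neq0 t : words t != [::].
Proof.
elim: t => //= s IHs t IHt; rewrite -size_eq0.
  by rewrite size_cat addn_eq0 size_eq0 (negbTE IHs).
by rewrite size_allpairs muln_eq0 !size_eq0 negb_or IHs.
Qed.

Lemma mem_words_neq0 t w : w \in words t -> w != [::].
Proof.
elim: t w => [n|s IHs t IHt|s IHs t IHt] w /=; first by rewrite inE => /eqP->.
  by rewrite mem_cat => /orP[/IHs|/IHt].
by case/allpairsP => -[x y] /= [/IHs x0 _ ->]; case: x x0.
Qed.

Lemma weight_le_eval (a : nat -> algN) t w :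
  w \in words t -> weight a w <= eval a t.
Proof.
elim: t w => [n|s IHs t IHt|s IHs t IHt] w /=.
- by rewrite inE => /eqP->; rewrite weight_cons /weight big_nil addn0.
- by rewrite mem_cat leq_max => /orP[/IHs->|/IHt->]; rewrite ?orbT.
- case/allpairsP => -[x y] /= [/IHs x0 /IHt y0 ->].
  by rewrite weight_cat leq_add.
Qed.

Lemma eval_attained (a : nat -> algN) t :
  exists2 w, w \in words t & eval a t = weight a w.
Proof.
elim: t => [n|s [w ws es] t [z zt et]|s [w ws es] t [z zt et]] /=.
- by exists [:: n]; rewrite ?inE // weight_cons /weight big_nil addn0.
- rewrite es et; case: (leqP (weight a w) (weight a z)) => h.
    by exists z; rewrite ?mem_cat ?zt ?orbT.
  by exists w; rewrite ?mem_cat ?ws.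
- exists (w ++ z); first exact: allpairs_f.
  by rewrite es et weight_cat.
Qed.

(** * The finite bases for k = 1 and k = 2 *)

Section Basis.

Let x := Var 0.
Let y := Var 1.
Let z := Var 2.

Definition basis (k : nat) : seq identity :=
  [:: (Add x (Add y z), Add (Add x y) z);
      (Add x y, Add y x);
      (Add x x, x);
      (Mul x (Mul y z), Mul (Mul x y) z);
      (Mul x y, Mul y x);
      (Mul x (Add y z), Add (Mul x y) (Mul x z));
      (Add x (Mul x y), Mul x y);
      (Add (Mul x y) (Add (Mul x x) (Mul y y)), Add (Mul x x) (Mul y y));
      (tpow x k, tpow x k.+1)].

End Basis.

Lemma varP_basis k A : varP k A -> models (fun e => List.In e (basis k)) A.
Proof.
case=> MA Ak e /= ine.
repeat (case: ine => [<-|ine]);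
  try by apply: (varM_satisfies MA) => v /=; lia.
exact: Ak.
Qed.

(** The laws shared by P_1 and P_2, where [flat_le_mul] reads x <= xy and
[flat_amgm] reads xy <= x^2 + y^2. *)
Record flat (A : algebra) : Prop := Flat {
  flat_addA : associative (@add A);
  flat_addC : commutative (@add A);
  flat_addI : idempotent_op (@add A);
  flat_mulA : associative (@mul A);
  flat_mulC : commutative (@mul A);
  flat_mulDr : right_distributive (@mul A) (@add A);
  flat_le_mul : forall x y : A, add x (mul x y) = mul x y;
  flat_amgm : forall x y : A,
    add (mul x y) (add (mul x x) (mul y y)) = add (mul x x) (mul y y);
  flat_cube : forall x : A, mul x (mul x x) = mul x x }.

Lemma basis_flat k A : 0 < k <= 2 ->
  models (fun e => List.In e (basis k)) A -> flat A.
Proof.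
move=> k12 mA.
pose v3 (x y z : A) (n : nat) : A := nth x [:: x; y; z] n.
have get n (x y z : A) (e := nth (Var 0, Var 0) (basis k) n) :
    n < 9 -> eval (v3 x y z) e.1 = eval (v3 x y z) e.2.
  move=> n9; apply: (mA e); rewrite /e.
  by move: n n9 @e; do 9![case=> [_ _ /=|]; first by tauto].
split.
- by move=> x y z; exact: (get 0 x y z).
- by move=> x y; exact: (get 1 x y x).
- by move=> x; exact: (get 2 x x x).
- by move=> x y z; exact: (get 3 x y z).
- by move=> x y; exact: (get 4 x y x).
- by move=> x y z; exact: (get 5 x y z).
- by move=> x y; exact: (get 6 x y x).
- by move=> x y; exact: (get 7 x y x).
- move=> x; have := get 8 x x x isT.
  by case: k k12 {mA get} => [|[|[|k]]] //= _ e; rewrite -?e.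
Qed.

(** One element is adjoined which is neutral for both operations, as 0 is in N:
it serves as the empty word and, by x <= xy, as the bottom. *)
Definition unital (A : algebra) : algebra :=
  {| carrier := option A;
     add := fun x y => match x, y with
       | Some a, Some b => Some (add a b) | None, _ => y | _, None => x end;
     mul := fun x y => match x, y with
       | Some a, Some b => Some (mul a b) | None, _ => y | _, None => x end;
     nonempty := inhabits None |}.

Lemma unital_flat A : flat A -> flat (unital A).
Proof.
case=> DA DC DI MA MC MD le amgm cube.
split; rewrite /associative /commutative /idempotent_op /right_distributive /=.
- by move=> [a|] [b|] [c|] //; rewrite DA.
- by move=> [a|] [b|] //; rewrite DC.
- by move=> [a|] //; rewrite DI.
- by move=> [a|] [b|] [c|] //; rewrite MA.
- by move=> [a|] [b|] //; rewrite MC.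
- by move=> [a|] [b|] [c|] //; rewrite ?MD ?DI ?le // DC le.
- by move=> [a|] [b|] //; rewrite ?le ?DI.
- by move=> [a|] [b|] //; rewrite ?amgm ?le.
- by move=> [a|] //; rewrite cube.
Qed.

Section FlatCompleteness.
#[local] Arguments mul : simpl never.
#[local] Arguments add : simpl never.
Variable A : algebra.
Hypothesis flatA : flat A.
Local Notation U := (unital A).
Let flatU : flat U := unital_flat flatA.
Let one : U := None.
Local Notation "x <<= y" := (add (x : U) (y : U) = y) (at level 70).
Local Infix "**" := (@mul U) (at level 40).
Local Infix "++_" := (@add U) (at level 50).

Let addA := flat_addA flatU.
Let addC := flat_addC flatU.
Let addI := flat_addI flatU.
Let mulA := flat_mulA flatU.
Let mulC := flat_mulC flatU.
Let mulDr := flat_mulDr flatU.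

Lemma mul1 (x : U) : one ** x = x. Proof. by []. Qed.
Lemma mulr1 (x : U) : x ** one = x. Proof. by case: x. Qed.
Lemma le_trans (x y z : U) : x <<= y -> y <<= z -> x <<= z.
Proof. by move=> xy yz; rewrite -yz addA xy. Qed.
Lemma le_anti (x y : U) : x <<= y -> y <<= x -> x = y.
Proof. by move=> xy yx; rewrite -yx addC. Qed.
Lemma le_addl (x y : U) : x <<= x ++_ y.
Proof. by rewrite addA addI. Qed.
Lemma le_addr (x y : U) : y <<= x ++_ y.
Proof. by rewrite addC -addA addI. Qed.
Lemma add_le (x y z : U) : x <<= z -> y <<= z -> x ++_ y <<= z.
Proof. by move=> xz yz; rewrite -addA yz. Qed.
Lemma le_mulr (x y : U) : x <<= x ** y.
Proof. exact: (flat_le_mul flatU). Qed.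
Lemma mul_le2l (x y z : U) : y <<= z -> x ** y <<= x ** z.
Proof. by move=> yz; rewrite -mulDr yz. Qed.
Lemma mul_le2r (x y z : U) : y <<= z -> y ** x <<= z ** x.
Proof. by rewrite ![_ ** x]mulC; exact: mul_le2l. Qed.

Variable nu : nat -> A.
Let ev (w : seq nat) : U := foldr (fun i x => Some (nu i) ** x) one w.

Lemma ev_cat w z : ev (w ++ z) = ev w ** ev z.
Proof. by elim: w => [|i w IHw] //=; rewrite IHw mulA. Qed.

Lemma ev_rem i w : i \in w -> ev w = Some (nu i) ** ev (rem i w).
Proof.
elim: w => //= j w IHw; rewrite inE eq_sym.
case: eqVneq => [->|_] //= iw.
by rewrite (IHw iw) !mulA (mulC (Some (nu j))).
Qed.

Lemma ev_count2 i w : 1 < count_mem i w -> Some (nu i) ** Some (nu i) <<= ev w.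
Proof.
move=> c2; have iw : i \in w by rewrite -has_pred1 has_count; lia.
have iw' : i \in rem i w.
  by rewrite -has_pred1 has_count count_rem iw /= eqxx subn_gt0.
by rewrite (ev_rem iw) (ev_rem iw') mulA; exact: le_mulr.
Qed.

(** With s the sum of the letters of w, the sum of their squares is s^2 by
xy <= x^2 + y^2, and s^2 is above every power of s by x^2 = x^3, hence above
w. *)
Lemma ev_le_of_squares (w : seq nat) (p y : U) : p <<= y ->
  (forall i, i \in w -> p ** (Some (nu i) ** Some (nu i)) <<= y) ->
  p ** ev w <<= y.
Proof.
move=> py wy.
pose s (w : seq nat) : U := foldr (fun i x => Some (nu i) ++_ x) one w.
have s2 : p ** (s w ** s w) <<= y.
  elim: w wy => [|i w IHw] wy; first by rewrite mulr1.
  have {IHw} sw : p ** (s w ** s w) <<= y.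
    by apply: IHw => j jw; apply: wy; rewrite inE jw orbT.
  have -> : s (i :: w) ** s (i :: w) =
      Some (nu i) ** Some (nu i) ++_ s w ** s w.
    rewrite [s _](_ : _ = Some (nu i) ++_ s w) // mulDr.
    rewrite !(mulC (_ ++_ s w)) !mulDr.
    set a := Some _; set b := s w.
    rewrite (mulC b a) addA -(addA (a ** a)) addI (addC (a ** a)) -addA.
    exact: (flat_amgm flatU).
  by rewrite mulDr; apply: add_le => //; apply: wy; rewrite inE eqxx.
apply: le_trans s2; apply: mul_le2l; elim: w {wy} => [|i w IHw] //.
have sw : s w <<= s (i :: w) by exact: le_addr.
have si : Some (nu i) <<= s (i :: w) by exact: le_addl.
rewrite -(flat_cube flatU (s (i :: w))).
apply: (le_trans (y := Some (nu i) ** (s w ** s w))); first exact: mul_le2l.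
apply: le_trans (mul_le2r _ si) _; apply: mul_le2l.
exact: le_trans (mul_le2r _ sw) (mul_le2l _ sw).
Qed.

Lemma weight_rem (a : nat -> nat) i w :
  i \in w -> weight a w = a i + weight a (rem i w).
Proof. by move=> iw; rewrite (weight_perm a (perm_to_rem iw)) weight_cons. Qed.

(** The heart of completeness: domination of w by V in every valuation of N is
turned into an inequality between products in A.  The factor p accumulates the
letters cancelled along the induction, and the sum of the words of V is replaced
by an arbitrary upper bound y of them. *)
Lemma ev_le (w : seq nat) (V : seq (seq nat)) (p y : U) :
  (forall a, exists2 t, t \in V & weight a w <= weight a t) ->
  (forall t, t \in V -> p ** ev t <<= y) -> p ** ev w <<= y.
Proof.
have [m] := ubnP (size w).
elim: m w V p => // m IHm w V p wm dom Vy.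
case: (pselect (forall i, i \in w -> exists2 t, t \in V & 1 < count_mem i t)).
  move=> dbl; apply: ev_le_of_squares => [|i /dbl[t tV it]].
    have [t tV _] := dom (fun=> 0).
    by apply: le_trans (Vy t tV); exact: le_mulr.
  by apply: le_trans (Vy t tV); apply: mul_le2l; exact: ev_count2.
move/existsNP => [i /not_implyP[iw noti]].
have V1 t : t \in V -> count_mem i t <= 1.
  by move=> tV; rewrite leqNgt; apply/negP => it; apply: noti; exists t.
pose V' := [seq rem i t | t <- V & i \in t].
rewrite (ev_rem iw) mulA; apply: (IHm _ V').
- by rewrite size_rem // (leq_trans _ (wm : _ <= m)) //; case: (w) iw.
- move=> a.
  (* M exceeds the weight of every word of V, so that under a', which gives i
     the value M, a word of V without i cannot dominate w. *)
  pose M := (a i + \sum_(t <- V) weight a t).+1.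
  pose a' j := if j == i then M else a j.
  have aa' t : weight a t <= weight a' t.
    by apply: leq_sum => j _; rewrite /a'; case: eqP => // ->; rewrite /M; lia.
  have aa'' t : i \notin t -> weight a' t = weight a t.
    move=> it; apply: eq_big_seq => j jt; rewrite /a'.
    by case: eqP it => // <-; rewrite jt.
  have Mt t : t \in V -> weight a t < M.
    by move=> tV; rewrite /M (big_rem t) //=; lia.
  have a'i : a' i = M by rewrite /a' eqxx.
  have [t tV wt] := dom a'.
  rewrite (weight_rem a' iw) a'i in wt.
  have it : i \in t.
    by apply: contraT => it; have := Mt _ tV; rewrite (aa'' _ it) in wt; lia.
  rewrite (weight_rem a' it) a'i leq_add2l in wt.
  exists (rem i t); first by apply: map_f; rewrite mem_filter it.
  apply: leq_trans (aa' _) _; apply: leq_trans wt _; rewrite aa'' //.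
  by rewrite -has_pred1 has_count count_rem it /= eqxx subn_gt0 -leqNgt V1.
- move=> t' /mapP[t]; rewrite mem_filter => /andP[it tV] ->.
  by rewrite -mulA -(ev_rem it); exact: Vy.
Qed.

Let evalU (t : term) : U := Some (eval nu t).

Lemma ev_le_eval t w : w \in words t -> ev w <<= evalU t.
Proof.
rewrite /evalU; elim: t w => [n|s IHs t IHt|s IHs t IHt] w /=.
- by rewrite inE => /eqP->; exact: addI.
- rewrite mem_cat => /orP[/IHs|/IHt] h; apply: le_trans h _.
    exact: (le_addl (Some _) (Some _)).
  exact: (le_addr (Some _) (Some _)).
- case/allpairsP => -[x z] /= [/IHs xs /IHt zt ->]; rewrite ev_cat.
  exact: le_trans (mul_le2r _ xs) (mul_le2l (Some _) zt).
Qed.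

Lemma eval_le t (p y : U) :
  (forall w, w \in words t -> p ** ev w <<= y) -> p ** evalU t <<= y.
Proof.
rewrite /evalU; elim: t p => [n|s IHs t IHt|s IHs t IHt] p /= h.
- by apply: (h [:: n]); rewrite inE.
- rewrite (mulDr p (Some _) (Some _)).
  apply: add_le; [apply: IHs|apply: IHt] => w wt.
    by apply: h; rewrite mem_cat wt.
  by apply: h; rewrite mem_cat wt orbT.
- rewrite (mulA p (Some _) (Some _)); apply: IHt => z zt.
  rewrite -mulA (mulC (Some _)) mulA; apply: IHs => w ws.
  by rewrite -mulA (mulC (ev z)) -ev_cat; apply: h; exact: allpairs_f.
Qed.

Lemma flat_eval_le s t : (forall a : nat -> algN, eval a s <= eval a t) ->
  evalU s <<= evalU t.
Proof.
move=> st; rewrite -[evalU s]mul1; apply: eval_le => w ws.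
apply: (ev_le (V := words t)) => [a|z zt]; last first.
  by rewrite mul1; exact: ev_le_eval.
have [z zt ez] := eval_attained a t; exists z => //.
by rewrite -ez; apply: leq_trans (st a); exact: weight_le_eval.
Qed.

Lemma flat_eval_eq s t : satisfies algN (s, t) -> eval nu s = eval nu t.
Proof.
move=> st; apply: Some_inj.
by apply: le_anti; apply: flat_eval_le => a; rewrite (st a).
Qed.

End FlatCompleteness.

Lemma varP_finitely_based k : 0 < k <= 2 -> finitely_based (varP k).
Proof.
move=> k12; exists (basis k) => A; split; first exact: varP_basis.
move=> mA; split; last by apply: mA; do 8 right; left.
have fA := basis_flat k12 mA.
by apply: birkhoff => -[s t] st v; exact: flat_eval_eq.
Qed.

(** * Syntactic quotients of the term algebra *)

(** The multiplicative contexts keeping t inside D.  The empty context is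
included, although no term denotes it, so that t itself is tested. *)
Definition contexts (D : seq nat -> Prop) (t : algT) (p : seq nat) : Prop :=
  forall w, w \in words t -> D (p ++ w).

Definition synt (D : seq nat -> Prop) : algebra := quotient (contexts D).

Section Syntactic.
Variable D : seq nat -> Prop.
Hypothesis D_perm : forall w z, perm_eq w z -> D w -> D z.

Lemma contextsD s t p :
  contexts D (Add s t) p <-> contexts D s p /\ contexts D t p.
Proof.
split=> [h|[hs ht] w /=]; last by rewrite mem_cat => /orP[/hs|/ht].
by split=> w h'; apply: h; rewrite /= mem_cat h' ?orbT.
Qed.

Lemma contextsM s t p :
  contexts D (Mul s t) p <-> forall w, w \in words s -> contexts D t (p ++ w).
Proof.
split=> [h w ws z zt|h w /allpairsP[[x y] /= [xs yt ->]]].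
  by rewrite -catA; apply: h; exact: allpairs_f.
by rewrite catA; exact: h.
Qed.

Lemma contextsC s t p : contexts D (Mul s t) p -> contexts D (Mul t s) p.
Proof.
move=> h w /allpairsP[[x y] /= [xs yt ->]].
apply: (@D_perm (p ++ (y ++ x))); first by rewrite perm_cat2l perm_catC.
by apply: h; exact: allpairs_f.
Qed.

Lemma satisfies_synt e : satisfies (synt D) e <->
  forall (v : nat -> algT) p,
    contexts D (eval v e.1) p <-> contexts D (eval v e.2) p.
Proof.
have ctxP s t : contexts D s = contexts D t <->
    forall p, contexts D s p <-> contexts D t p.
  split=> [-> //|st]; apply: funext => p; exact: propext.
have half s s' t : contexts D s = contexts D s' ->
    forall p, contexts D (Mul t s) p -> contexts D (Mul t s') p.
  move=> /ctxP ss' p /contextsM h; apply/contextsM => w wt.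
  by apply/ss'; exact: h.
have Ml s s' t : contexts D s = contexts D s' ->
    contexts D (Mul t s) = contexts D (Mul t s').
  by move=> ss'; apply/ctxP => p; split; apply: half.
have MC s t : contexts D (Mul s t) = contexts D (Mul t s).
  by apply/ctxP => p; split; exact: contextsC.
have ctxD s s' t t' : contexts D s = contexts D s' ->
    contexts D t = contexts D t' ->
    contexts D (Add s t) = contexts D (Add s' t').
  move=> /ctxP ss' /ctxP tt'; apply/ctxP => p.
  by split=> /contextsD[/ss' ? /tt' ?]; apply/contextsD.
have ctxM s s' t t' : contexts D s = contexts D s' ->
    contexts D t = contexts D t' ->
    contexts D (Mul s t) = contexts D (Mul s' t').
  by move=> ss' tt'; rewrite (Ml _ _ _ tt') MC (Ml _ _ _ ss') MC.
have := @satisfies_quotient algT _ (contexts D) ctxD ctxM e.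
by rewrite -/(synt D) => ->; split=> h v; apply/ctxP; exact: h.
Qed.

Lemma tpow_letter (v : nat -> algT) t k : exists l, exists2 w,
  w \in words (eval v (tpow t k.+1) : term) & k < count_mem l w.
Proof.
have : words (eval v t : term) != [::] := words_neq0 _.
case E : (words _) => [//|z r] _.
have : z \in words (eval v t : term) by rewrite E inE eqxx.
move=> zt; have := mem_words_neq0 zt.
case: z {E} zt => // l z zt _; exists l; elim: k => [|k [w wt lw]].
  by exists (l :: z); rewrite //= eqxx.
exists ((l :: z) ++ w); first exact: allpairs_f.
rewrite count_cat /= eqxx -addnA add1n ltnS; exact: leq_trans lw (leq_addl _ _).
Qed.

(** If no word of D contains a letter k times, a k-th power has no context at
all, and neither has the next power. *)
Lemma synt_power k : (forall w l, D w -> count_mem l w < k) ->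
  satisfies (synt D) (tpow (Var 0) k, tpow (Var 0) k.+1).
Proof.
move=> Dk; apply/satisfies_synt => v p /=.
have bad j : k <= j.+1 -> ~ contexts D (eval v (tpow (Var 0) j.+1)) p.
  move=> kj h; have [l [w wj lw]] := tpow_letter v (Var 0) j.
  have := Dk _ l (h _ wj); rewrite count_cat ltnNge; apply/negP/negPn.
  exact: leq_trans kj (leq_trans lw (leq_addl _ _)).
have badS : ~ contexts D (eval v (tpow (Var 0) k.+1)) p by exact: bad.
case: k bad badS {Dk} => [|k] bad badS; first by split.
by split=> h; [case: (bad k (leqnn _) h)|case: (badS h)].
Qed.

End Syntactic.

(** * The cyclic words and their hulls *)

(** The letters 0, ..., n - 1 with the cyclic successor of i replaced by a
second i. *)
Definition cyc (n i : nat) : seq nat := i :: rem (i.+1 %% n) (iota 0 n).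

Lemma count_cyc n i l : i < n ->
  count_mem l (cyc n i) = (l == i) + ((l < n) - (l == i.+1 %% n)).
Proof.
move=> ni; have n0 : 0 < n by exact: leq_ltn_trans ni.
rewrite /= eq_sym count_rem mem_iota ltn_pmod //=.
by rewrite count_uniq_mem ?iota_uniq // mem_iota /= (eq_sym (_ %% _)).
Qed.

Lemma weight_cyc a n i : i < n ->
  weight a (cyc n i) + a (i.+1 %% n) = a i + weight a (iota 0 n).
Proof.
move=> ni; rewrite weight_cons -addnA [_ + a (_ %% _)]addnC; congr (_ + _).
rewrite -weight_rem // mem_iota ltn_pmod //; exact: leq_ltn_trans ni.
Qed.

Definition cyc_divisor (n : nat) (z : seq nat) : Prop :=
  exists2 i, i < n & forall l, count_mem l z <= count_mem l (cyc n i).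

(** The words below the convex hull of the [cyc n j] for j in J, described
dually by linear forms. *)
Definition hull (n : nat) (J : seq nat) (z : seq nat) : Prop :=
  forall a, exists2 j, (j < n) && (j \in J) & weight a z <= weight a (cyc n j).

Lemma cyc_divisor_perm n w z : perm_eq w z ->
  cyc_divisor n w -> cyc_divisor n z.
Proof. by move=> /permP wz [i ni h]; exists i => // l; rewrite -wz. Qed.

Lemma hull_perm n J w z : perm_eq w z -> hull n J w -> hull n J z.
Proof. by move=> /weight_perm wz h a; rewrite -wz. Qed.

Lemma weight_count i z : weight (fun j => j == i) z = count_mem i z.
Proof.
by elim: z => [|j z IHz]; rewrite ?weight_cons ?IHz // /weight big_nil.
Qed.

Lemma weightD a b z : weight (fun j => a j + b j) z = weight a z + weight b z.
Proof. exact: big_split. Qed.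

Lemma weight_le_counts a w z : (forall l, count_mem l w <= count_mem l z) ->
  weight a w <= weight a z.
Proof.
elim: w z => [|i w IHw] z h; first by rewrite /weight big_nil.
have iz : i \in z by have := h i; rewrite -has_pred1 has_count /= eqxx; lia.
rewrite weight_cons (weight_rem _ iz) leq_add2l; apply: IHw => l.
have := h l; have := h i; rewrite count_rem iz /= eqxx.
by case: eqP => [<-|_] /=; lia.
Qed.

Lemma cyc_divisor_hull n i J z : i < n -> i \in J ->
  (forall l, count_mem l z <= count_mem l (cyc n i)) -> hull n J z.
Proof.
by move=> ni iJ h a; exists i; rewrite ?ni //; exact: weight_le_counts.
Qed.

Section Hull.
Variables (n : nat) (J : seq nat) (z : seq nat).
Hypothesis n2 : 1 < n.
Hypothesis zJ : hull n J z.

Lemma succ_neq i : i < n -> i.+1 %% n != i.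
Proof.
move=> ni; have [e|ne] := eqVneq i.+1 n; first by rewrite e modnn; lia.
by rewrite modn_small; lia.
Qed.

Lemma hull_count l : count_mem l z <= 2 * (l < n).
Proof.
have [j /andP[nj _]] := zJ (fun j => j == l).
rewrite !weight_count count_cyc //; move/leq_trans; apply.
by case: eqP => [->|_]; case: eqP; case: (ltnP l n); lia.
Qed.

Lemma hull_count2 i l : l != i -> count_mem i z + count_mem l z <= 3.
Proof.
move=> li.
have [j /andP[nj _]] := zJ (fun j => (j == i) + (j == l)).
rewrite !weightD !weight_count !count_cyc //; move/leq_trans; apply.
have [ij|_] := eqVneq i j; have [lj|_] := eqVneq l j; last by lia.
- by rewrite lj ij eqxx in li.
- by lia.
- by lia.
Qed.

Lemma hull_count_succ i : i < n ->
  2 * count_mem i z + count_mem (i.+1 %% n) z <= 4.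
Proof.
move=> ni; have si := succ_neq ni.
have [j /andP[nj _]] := zJ (fun j => (j == i) + ((j == i) + (j == i.+1 %% n))).
rewrite !weightD !weight_count !count_cyc // => h.
have [ij|ij] := eqVneq i j; last by lia.
by rewrite -ij in h; lia.
Qed.

(** Only the [cyc n j] with j in J matter, so the valuation may increase by one
at each cyclic step except from j0: it gives every such [cyc n j] a smaller
weight than the product of all letters. *)
Lemma hull_full j0 : j0 < n -> j0 \notin J ->
  ~ (forall i, i < n -> 0 < count_mem i z).
Proof.
move=> nj0 j0J full.
pose a j := (j + (n - j0.+1)) %% n.
have step j : j < n -> j != j0 -> a (j.+1 %% n) = (a j).+1.
  move=> nj jj0; rewrite /a modnDml addSn.
  have [lt|ge] := ltnP j j0.
    by rewrite !modn_small; lia.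
  have -> : j + (n - j0.+1) = (j - j0.+1) + n by lia.
  by rewrite -addSn !modnDr !modn_small; lia.
have [j /andP[nj jJ] h] := zJ a.
have jj0 : j != j0 by apply: contraNneq j0J => <-.
have wz : weight a (iota 0 n) <= weight a z.
  apply: weight_le_counts => l.
  rewrite count_uniq_mem ?iota_uniq // mem_iota /= add0n.
  by case: ltnP => // nl; exact: full.
have := weight_cyc a nj; rewrite step //; lia.
Qed.

(** A word of the hull with a letter i occurring twice divides [cyc n i], by the
bounds on counts above.  Otherwise no letter is repeated, some letter i is
missing by [hull_full], and the word divides [cyc n j] for j the cyclic
predecessor of i. *)
Lemma hull_cyc_divisor j0 : j0 < n -> j0 \notin J -> cyc_divisor n z.
Proof.
move=> nj0 j0J.
case: (pselect (exists2 i, i < n & 1 < count_mem i z)) => [[i ni i2]|no2].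
  exists i => // l; rewrite count_cyc //.
  have cl := hull_count l.
  have [-> |li] := eqVneq l i.
    have := hull_count i; rewrite ni (eq_sym i) (negbTE (succ_neq ni)); lia.
  have := hull_count2 li; have := hull_count_succ ni.
  case: eqP => [->|_]; last by lia.
  by lia.
have [i ni i0] : exists2 i, i < n & count_mem i z = 0.
  apply: contrapT => no0; apply: (hull_full nj0 j0J) => i ni.
  by rewrite lt0n; apply/eqP => i0; apply: no0; exists i.
pose j := (i + n.-1) %% n.
have nj : j < n by rewrite ltn_pmod; lia.
have ji : j.+1 %% n = i.
  rewrite -addn1 modnDml -addnA addn1 prednK ?modnDr ?modn_small //; lia.
exists j => // l; rewrite count_cyc // ji.
have := hull_count l; have [-> |li] := eqVneq l i; first by rewrite i0.
case: ltnP => [nl _|_]; last by lia.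
have : ~ 1 < count_mem l z by move=> l2; apply: no2; exists l.
by lia.
Qed.

End Hull.

(** The hull is defined by bounding linear forms, so membership of all the words
of p t depends only on the function that t induces on N. *)
Lemma varM_hull n J : varM (synt (hull n J)).
Proof.
apply: birkhoff => -[s t] st.
apply/satisfies_synt => [w z|v p /=]; first exact: hull_perm.
suff half (s' t' : algT) : (forall a : nat -> algN,
    eval a (s' : term) = eval a (t' : term)) ->
    contexts (hull n J) t' p -> contexts (hull n J) s' p.
  by split; apply: half => a; rewrite !eval_subst (st (fun n => _)).
move=> e h w ws a.
have [z zt ez] := eval_attained a t'.
have [j jJ zj] := h z zt a; exists j => //; apply: leq_trans zj.
by rewrite !weight_cat leq_add2l -ez -e; exact: weight_le_eval.
Qed.

Lemma varP_hull n J k : 1 < n -> 2 < k -> varP k (synt (hull n J)).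
Proof.
move=> n2 k3; split; first exact: varM_hull.
apply: synt_power => [w z|w l hw]; first exact: hull_perm.
by have := hull_count n2 hw l; lia.
Qed.

(** * An identity of N failing in the cyclic quotient *)

Definition word_term (w : seq nat) : term :=
  if w is i :: w' then foldl (fun t j => Mul t (Var j)) (Var i) w' else Var 0.

Definition poly_term (s : seq (seq nat)) : term :=
  if s is w :: s' then foldl (fun t z => Add t (word_term z)) (word_term w) s'
  else Var 0.

Lemma words_word_term w : w != [::] -> words (word_term w) = [:: w].
Proof.
case: w => // i w _ /=.
have : words (Var i) = [:: [:: i]] by [].
rewrite -[i :: w]cat1s; elim: w [:: i] (Var i) => [|j w IHw] z t /= et.
  by rewrite cats0.
by rewrite (IHw (rcons z j)) ?cat_rcons //= et /= cats1.
Qed.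

Lemma words_poly_term s : s != [::] -> all (fun w => w != [::]) s ->
  words (poly_term s) = s.
Proof.
case: s => // w s _ /= /andP[w0 s0].
rewrite -[RHS]cat1s; move/words_word_term: w0.
elim: s [:: w] (word_term w) s0 => [|z s IHs] r t /=.
  by rewrite cats0.
case/andP => z0 s0 et; rewrite (IHs (rcons r z)) ?cat_rcons //=.
by rewrite et words_word_term // cats1.
Qed.

Lemma eval_words (v : nat -> algN) t m :
  (eval v t <= m) = all (fun w => weight v w <= m) (words t).
Proof.
apply/idP/allP => [tm w wt|h]; first exact: leq_trans (weight_le_eval v wt) tm.
by have [w wt ->] := eval_attained v t; exact: h.
Qed.

Definition cyc_identity (n : nat) : identity :=
  let t := poly_term [seq cyc n i | i <- iota 0 n] in
  (Add (word_term (iota 0 n)) t, t).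

Lemma words_cyc n : 0 < n ->
  words (poly_term [seq cyc n i | i <- iota 0 n]) =
  [seq cyc n i | i <- iota 0 n].
Proof.
case: n => // n _; apply: words_poly_term => //.
by apply/allP => w /mapP[i _ ->].
Qed.

Lemma words_iota n : 0 < n -> words (word_term (iota 0 n)) = [:: iota 0 n].
Proof. by case: n => // n _; exact: words_word_term. Qed.

(** At an index i where a is maximal, a does not increase from i to its cyclic
successor, so [cyc n i] weighs at least as much as the product of all
letters. *)
Lemma algN_cyc_identity n : 0 < n -> satisfies algN (cyc_identity n).
Proof.
move=> n0 a /=; apply/maxn_idPr.
rewrite eval_words words_iota //= andbT.
have [i ni imax] : exists2 i, i < n & forall j, j < n -> a j <= a i.
  case: n n0 => // n _.
  have [i _ imax] := arg_maxnP (P := predT) (fun i : 'I_n.+1 => a i)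
    (isT : predT ord0).
  by exists i => // j nj; exact: (imax (Ordinal nj)).
apply: (leq_trans (n := weight a (cyc n i))).
  have := weight_cyc a ni; have := imax _ (ltn_pmod i.+1 n0); lia.
by apply: weight_le_eval; rewrite words_cyc //; apply: map_f; rewrite mem_iota.
Qed.

Lemma synt_cyc_identity n : 1 < n ->
  ~ satisfies (synt (cyc_divisor n)) (cyc_identity n).
Proof.
move=> n2 /satisfies_synt => /(_ (@cyc_divisor_perm n) Var [::]).
have subE t : eval (A := algT) Var t = t by elim: t => //= s -> t ->.
rewrite !subE => -[_ h].
have n0 : 0 < n by exact: ltnW.
have /contextsD[+ _] : contexts (cyc_divisor n) (cyc_identity n).1 [::].
  apply: h => w; rewrite words_cyc // => /mapP[i].
  by rewrite mem_iota => /= ni ->; exists i.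
move/(_ (iota 0 n)); rewrite words_iota // inE => /(_ (eqxx _))[i ni].
move/(_ (i.+1 %% n)); rewrite count_cyc // count_uniq_mem ?iota_uniq //.
by rewrite mem_iota ltn_pmod //= eqxx (negbTE (succ_neq n2 ni)).
Qed.

(** * Small identities of P_k hold in the cyclic quotient *)

Fixpoint leaves (t : term) : nat :=
  match t with Var _ => 1 | Add s t | Mul s t => leaves s + leaves t end.

(** A bound on the number of words of t once its variables are replaced by
sums of at most m words. *)
Fixpoint expansion_bound (m : nat) (t : term) : nat :=
  match t with
  | Var _ => m
  | Add s t => expansion_bound m s + expansion_bound m t
  | Mul s t => expansion_bound m s * expansion_bound m t
  end.

Lemma size_words_subst (v : nat -> algT) m t :
  (forall n, size (words (v n)) <= m) ->
  size (words (eval v t : term)) <= expansion_bound m t.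
Proof.
move=> vm; elim: t => //= [s IHs t IHt|s IHs t IHt].
  by rewrite size_cat leq_add.
by rewrite size_allpairs leq_mul.
Qed.

Lemma words_subst_sub (v v' : nat -> algT) t :
  (forall n, {subset words (v n) <= words (v' n)}) ->
  {subset words (eval v t : term) <= words (eval v' t : term)}.
Proof.
move=> vv'; elim: t => //= [s IHs t IHt|s IHs t IHt] w.
  by rewrite !mem_cat => /orP[/IHs->|/IHt->]; rewrite ?orbT.
by case/allpairsP => -[x y] /= [/IHs xs /IHt yt ->]; exact: allpairs_f.
Qed.

(** A single word of a substituted term uses only boundedly many words of the
substitution, one for each leaf of the term. *)
Lemma used_words (v : nat -> algT) t w : w \in words (eval v t : term) ->
  exists s : nat -> seq (seq nat),
  [/\ forall n, {subset s n <= words (v n)}, forall n, size (s n) <= leaves t &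
      forall v' : nat -> algT, (forall n, {subset s n <= words (v' n)}) ->
        w \in words (eval v' t : term)].
Proof.
elim: t w => [n|s IHs t IHt|s IHs t IHt] w /=.
- move=> wn; exists (fun m => if m == n then [:: w] else [::]); split.
  + by move=> m z; case: eqP => // ->; rewrite inE => /eqP->.
  + by move=> m; case: eqP.
  + by move=> v' /(_ n w); rewrite eqxx; apply; rewrite inE.
- rewrite mem_cat => /orP[/IHs|/IHt] [f [fv fs fw]]; exists f; split => //.
  + by move=> n; rewrite (leq_trans (fs n)) ?leq_addr.
  + by move=> v' /fw; rewrite mem_cat => ->.
  + by move=> n; rewrite (leq_trans (fs n)) ?leq_addl.
  + by move=> v' /fw; rewrite mem_cat => ->; rewrite orbT.
- case/allpairsP => -[x y] /= [/IHs[f [fv fs fx]] /IHt[g [gv gs gy]] ->].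
  exists (fun n => f n ++ g n); split.
  + by move=> n z; rewrite mem_cat => /orP[/fv|/gv].
  + by move=> n; rewrite size_cat leq_add.
  + move=> v' h; apply: allpairs_f; [apply: fx|apply: gy] => n z zn;
      by apply: h; rewrite mem_cat zn ?orbT.
Qed.

Definition support_bound (e : identity) : nat :=
  expansion_bound (leaves e.1).+1 e.2 + expansion_bound (leaves e.2).+1 e.1.

(** The substitution v is thinned out to v' so that w is still a word of s and t
gets fewer than n words, each with a multiple p z dividing some [cyc n (idx z)].
The indices idx z avoid some j0, so P_k applies in the hull they span, and
[hull_cyc_divisor] brings the result back to divisors. *)
Lemma small_half n k s t (v : nat -> algT) p : 1 < n -> 2 < k ->
  (forall A, varP k A -> satisfies A (s, t)) ->
  expansion_bound (leaves s).+1 t < n ->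
  contexts (cyc_divisor n) (eval v t) p ->
  contexts (cyc_divisor n) (eval v s) p.
Proof.
move=> n2 k3 st small Dt w ws.
have [f [fv fs fw]] := used_words ws.
(* The head word only ensures that v' m is a nonempty sum; it accounts for the
   successor in the size bound. *)
pose v' m : algT := poly_term (head [::] (words (v m)) :: f m).
have subv m : {subset head [::] (words (v m)) :: f m <= words (v m)}.
  move=> z; rewrite inE => /orP[/eqP->|/fv//].
  by have := words_neq0 (v m); case: (words _) => // x r _; rewrite inE eqxx.
have wv' m : words (v' m) = head [::] (words (v m)) :: f m.
  by apply: words_poly_term => //; apply/allP => z /subv /mem_words_neq0.
have {}ws : w \in words (eval v' s : term).
  by apply: fw => m z zm; rewrite wv' inE zm orbT.
have Dt' z : z \in words (eval v' t : term) -> cyc_divisor n (p ++ z).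
  move=> zt; apply: Dt; apply: words_subst_sub zt => m y.
  by rewrite wv' => /subv.
have [idx idxP] : exists idx : seq nat -> nat, forall z,
    z \in words (eval v' t : term) -> idx z < n /\
    forall l, count_mem l (p ++ z) <= count_mem l (cyc n (idx z)).
  have /choice[idx h] : forall z, exists i, z \in words (eval v' t : term) ->
      i < n /\ forall l, count_mem l (p ++ z) <= count_mem l (cyc n i).
    move=> z; case: (boolP (z \in _)) => [/Dt'[i ni h]|_]; last by exists 0.
    by exists i.
  by exists idx.
pose J := map idx (words (eval v' t : term)).
have [j0 nj0 j0J] : exists2 j0, j0 < n & j0 \notin J.
  have /allPn[j0] : ~~ all (mem J) (iota 0 n).
    apply/negP => /allP sub; have := uniq_leq_size (iota_uniq 0 n) sub.
    rewrite size_iota size_map leqNgt => /negP; apply.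
    apply: leq_ltn_trans small.
    by apply: size_words_subst => m; rewrite wv' /= ltnS.
  by rewrite mem_iota => /= h ?; exists j0.
apply: (hull_cyc_divisor n2 _ nj0 j0J).
have /satisfies_synt := st _ (varP_hull J n2 k3).
move=> /(_ (@hull_perm n J) v' p) /= [_ h]; apply: h ws => z zt.
have [iz h] := idxP z zt; apply: (cyc_divisor_hull iz) h; exact: map_f.
Qed.

Lemma small_identity n k e : 1 < n -> 2 < k ->
  (forall A, varP k A -> satisfies A e) -> support_bound e < n ->
  satisfies (synt (cyc_divisor n)) e.
Proof.
case: e => s t n2 k3 st; rewrite /support_bound /= => small.
apply/satisfies_synt => [|v p /=]; first exact: cyc_divisor_perm.
split; apply: (small_half n2 k3); try (by lia); last exact: st.
by move=> A /st ts v'; rewrite /= (ts v').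
Qed.

Lemma varP_not_finitely_based k : 2 < k -> ~ finitely_based (varP k).
Proof.
move=> k3 [E basisE].
have [n n2 En] : exists2 n, 1 < n &
    forall e, List.In e E -> support_bound e < n.
  elim: E {basisE} => [|e E [n n2 En]]; first by exists 2.
  exists (n + (support_bound e).+1) => [|e' /= [<-|/En]]; lia.
have /basisE[MA _] : models (fun e => List.In e E) (synt (cyc_divisor n)).
  move=> e Ee; apply: (small_identity n2 k3) (En e Ee) => A /basisE mA.
  exact: mA.
apply: (synt_cyc_identity n2); apply: varM_satisfies MA _.
exact: algN_cyc_identity (ltnW n2).
Qed.

Theorem theorem10p3 :
  (forall k : nat, 1 <= k -> (finitely_based (varP k) <-> k <= 2)) /\
  (forall k : nat, 1 <= k -> proper_class (varP k) (varP k.+1)) /\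
  eq_class (join (fun k : nat => 1 <= k) varP) varM.
Proof.
split=> [k k1|]; last by split; [exact: varP_proper|exact: join_varP].
split=> [fb|k2]; last by apply: varP_finitely_based; rewrite k1.
by rewrite leqNgt; apply/negP => /varP_not_finitely_based.
Qed.
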